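(* Let $V\ge 1$ be a fixed integer. For each $\varpi>0$ let $\boldsymbol F=(F_1,\dots,F_V)$ be a probability vector (which may be fixed or may depend on $\varpi$), and let $\boldsymbol x$ and $\boldsymbol x^*$ be random vectors in $\mathbb R^V$ with $\boldsymbol x\sim \mathrm{PPU}(\varpi,\boldsymbol F)$ and $\boldsymbol x^*\sim \mathrm{Dir}(\varpi,\boldsymbol F)$. Then, for all such $\boldsymbol F$, $$d_{\mathrm{LP}}(\boldsymbol x,\boldsymbol x^* )\to 0\quad\text{as }\varpi\to\infty .$$
   Context: A probability vector is a vector with nonnegative entries summing to $1$. Dirichlet distribution, two-parameter form: for a concentration $\varpi>0$ and mean probability vector $\boldsymbol F$, $\mathrm{Dir}(\varpi,\boldsymbol F)$ denotes the Dirichlet distribution with parameter vector $\varpi\boldsymbol F$, i.e. the law of $\big(\gamma_1/\sum_{j=1}^V\gamma_j,\dots,\gamma_V/\sum_{j=1}^V\gamma_j\big)$ with independent $\gamma_j\sim\mathrm{Gamma}(\text{shape }\varpi F_j,\text{scale }1)$. Poisson Pólya urn distribution: $\mathrm{PPU}(\varpi,\boldsymbol F)$ is the law of $\big(\tilde\gamma_1/\sum_{j=1}^V\tilde\gamma_j,\dots,\tilde\gamma_V/\sum_{j=1}^V\tilde\gamma_j\big)$ where $\tilde\gamma_j\sim\mathrm{Poisson}(\varpi F_j)$ are independent, conditioned on $\sum_{j=1}^V\tilde\gamma_j\neq 0$. If $F_j=0$, the corresponding Gamma or Poisson variable is taken to be identically $0$. $d_{\mathrm{LP}}(\boldsymbol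 x,\boldsymbol x^* )$ denotes the Lévy–Prokhorov distance between the laws of $\boldsymbol x$ and $\boldsymbol x^*$ on $\mathbb R^V$; it metrizes convergence in distribution. *)

(* Defs.v *)
From HB Require Import structures.
From mathcomp Require Import all_boot all_order all_algebra.
From mathcomp Require Import all_classical all_reals all_analysis.
Import Order.TTheory GRing.Theory Num.Theory.
Import numFieldNormedType.Exports.

Set Implicit Arguments.
Unset Strict Implicit.
Unset Printing Implicit Defensive.

Local Open Scope classical_set_scope.
Local Open Scope ring_scope.

(* R^V is [V.-tuple R]; its library sigma-algebra is the product one, that is,
   the Borel sigma-algebra of R^V. *)

Definition probability_vector (R : realType) (V : nat) (F : V.-tuple R) : Prop :=
  (forall j, 0 <= tnth F j) /\ \sum_(j < V) tnth F j = 1.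

Definition normalize (R : realType) (V : nat) (g : 'I_V -> R) : V.-tuple R :=
  [tuple g j / (\sum_(k < V) g k) | j < V].

Definition mutually_independent (R : realType) (d d' : measure_display)
    (T : measurableType d) (S : measurableType d') (P : probability T R)
    (I : finType) (X : I -> {RV P >-> S}) : Prop :=
  forall (J : {set I}) (B : I -> set S), (forall j, measurable (B j)) ->
    P (\bigcap_(j in [set` J]) (X j @^-1` B j)) =
    (\prod_(j in J) P (X j @^-1` B j))%E.

Definition Gamma (R : realType) (a : R) : R :=
  \int[lebesgue_measure]_(t in `]0, +oo[) (t `^ (a - 1) * expR (- t)).

Definition gamma_pdf (R : realType) (a t : R) : R :=
  if 0 < t then t `^ (a - 1) * expR (- t) / Gamma a else 0.

(* Gamma(shape a, scale 1), degenerate at 0 when a = 0; [poisson_prob]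
   follows the same convention for rate 0 (its nat argument is unused). *)
Definition gamma_law (R : realType) (a : R) (U : set R) : \bar R :=
  if 0 < a then (\int[lebesgue_measure]_(t in U) (gamma_pdf a t)%:E)%E
  else \d_(0 : R) U.

Definition is_dirichlet (R : realType) (V : nat) (w : R) (F : V.-tuple R)
    (d : measure_display) (T : measurableType d) (P : probability T R)
    (x : {RV P >-> V.-tuple R}) : Prop :=
  exists (d0 : measure_display) (T0 : measurableType d0)
    (P0 : probability T0 R) (g : 'I_V -> {RV P0 >-> R}),
    [/\ mutually_independent g,
        forall j (U : set R), measurable U ->
          distribution P0 (g j) U = gamma_law (w * tnth F j) U
      & forall A : set (V.-tuple R), measurable A ->
          distribution P x A = P0 [set o | A (normalize (g ^~ o))]].

(* The last clause is the law of the normalized vector conditioned on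
   [nonzero], an event of positive probability when 0 < w. *)
Definition is_ppu (R : realType) (V : nat) (w : R) (F : V.-tuple R)
    (d : measure_display) (T : measurableType d) (P : probability T R)
    (x : {RV P >-> V.-tuple R}) : Prop :=
  exists (d0 : measure_display) (T0 : measurableType d0)
    (P0 : probability T0 R) (g : 'I_V -> {RV P0 >-> nat}),
    let nonzero := [set o | (\sum_(j < V) g j o)%N <> 0%N] in
    [/\ mutually_independent g,
        forall j (U : set nat),
          distribution P0 (g j) U = poisson_prob (w * tnth F j) 0 U
      & forall A : set (V.-tuple R), measurable A ->
          distribution P x A =
          (fine (P0 ([set o | A (normalize (fun j => (g j o)%:R))] `&` nonzero))
           / fine (P0 nonzero))%:E].

Definition euclidean_dist (R : realType) (V : nat) (a b : V.-tuple R) : R :=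
  Num.sqrt (\sum_(j < V) (tnth a j - tnth b j) ^+ 2).

Definition enlargement (R : realType) (V : nat) (A : set (V.-tuple R)) (e : R) :
    set (V.-tuple R) :=
  [set b | exists2 a, A a & euclidean_dist a b < e].

(* The infimum is over a nonempty set: it contains 1, since mu and nu are
   probabilities. *)
Definition levy_prokhorov (R : realType) (V : nat)
    (mu nu : probability (V.-tuple R) R) : R :=
  inf [set e : R | 0 < e /\
    forall A : set (V.-tuple R), measurable A ->
      (mu A <= nu (enlargement A e) + e%:E)%E /\
      (nu A <= mu (enlargement A e) + e%:E)%E].

(* Main.v *)
(* Both laws concentrate at F: a Poisson or Gamma variable of mean w F_j also has
   variance w F_j, so by Chebyshev it lies within r w of w F_j except with
   probability at most F_j / (r^2 w). A union bound over j makes every coordinate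
   close, with no need for independence, except with probability 1 / (r^2 w), and
   then the normalized vector is close to F, uniformly in F. Two laws that both give
   mass at least 1 - e to a set of diameter less than e are at Levy-Prokhorov
   distance at most e. *)
Require Import Defs.
From HB Require Import structures.
From mathcomp Require Import all_boot all_order all_algebra.
From mathcomp Require Import all_classical all_reals all_analysis.
From mathcomp Require Import measurable_realfun.
From mathcomp Require Import ring lra.
Import Order.TTheory GRing.Theory Num.Theory.
Import numFieldNormedType.Exports.

Set Implicit Arguments.
Unset Strict Implicit.
Unset Printing Implicit Defensive.

Local Open Scope classical_set_scope.
Local Open Scope ring_scope.

(** * Boxes, enlargements and the Lévy-Prokhorov distance *)

(** Sup-norm balls: finite intersections of coordinate conditions, hence measurable for the product
    sigma-algebra and directly accessible to coordinatewise tail bounds. *)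
Definition box (R : realType) (V : nat) (c : V.-tuple R) (r : R) :
    set (V.-tuple R) :=
  [set b | forall j, `|tnth b j - tnth c j| < r].

Lemma measurable_box (R : realType) (V : nat) (c : V.-tuple R) (r : R) :
  measurable (box c r).
Proof.
have -> : box c r =
    \bigcap_(j in [set: 'I_V]) ((@tnth V R)^~ j @^-1` ball (tnth c j) r).
  apply/seteqP; split => [b cb j _|b cb j].
    by rewrite /= /ball/= distrC; exact: cb.
  by have := cb j I; rewrite /= /ball/= distrC.
apply: fin_bigcap_measurable => // j _.
rewrite -[X in measurable X]setTI.
by apply: measurable_tnth => //; exact: measurable_ball.
Qed.

(* The increment of a sum of squares under a coordinatewise perturbation of size
   at most [r <= 1] is at most [r * M], with [M] as below. *)
Lemma enlargement_interior (R : realType) (V : nat) (A : set (V.-tuple R))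
    (e : R) (b : V.-tuple R) :
  enlargement A e b -> exists2 r : R, 0 < r & box b r `<=` enlargement A e.
Proof.
move=> [a Aa abe].
have e0 : 0 < e by apply: le_lt_trans abe; exact: sqrtr_ge0.
pose D : R := \sum_(j < V) (tnth a j - tnth b j) ^+ 2.
have D0 : 0 <= D by apply: sumr_ge0 => j _; rewrite sqr_ge0.
have De : D < e ^+ 2 by rewrite -(sqr_sqrtr D0) ltrXn2r// sqrtr_ge0.
pose M : R := \sum_(j < V) (2 * `|tnth a j - tnth b j| + 1).
have M0 : 0 <= M by apply: sumr_ge0 => j _; rewrite addr_ge0// mulr_ge0.
(* The cap at 1 gives r^2 <= r. Dividing by [M + 1] rather than [M] leaves D + r M <= e^2 - r, so
   the final inequality is strict. *)
have r0 : 0 < Num.min 1 ((e ^+ 2 - D) / (M + 1)).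
  by rewrite lt_min ltr01 divr_gt0 ?subr_gt0// ltr_wpDl.
exists (Num.min 1 ((e ^+ 2 - D) / (M + 1))) => //.
set r := Num.min _ _ in r0 *.
have r1 : r <= 1 by rewrite ge_min lexx.
have rM : r * (M + 1) <= e ^+ 2 - D.
  by rewrite -ler_pdivlMr ?ltr_wpDl// ge_min lexx orbT.
move=> c bc; exists a => //.
rewrite /euclidean_dist -[ltRHS](gtr0_norm e0) -sqrtr_sqr ltr_sqrt ?exprn_gt0//.
suff : \sum_(j < V) (tnth a j - tnth c j) ^+ 2 <= D + r * M by lra.
rewrite /D /M mulr_sumr -big_split/=; apply: ler_sum => j _.
have := bc j; set u := tnth a j; set v := tnth b j; set t := tnth c j => h.
have -> : (u - t) ^+ 2 = (u - v) ^+ 2 - 2 * ((u - v) * (t - v)) + (t - v) ^+ 2.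
  by ring.
have h1 : (t - v) ^+ 2 <= r.
  rewrite -real_normK ?num_real// expr2.
  have := normr_ge0 (t - v); nra.
have h2 : - ((u - v) * (t - v)) <= `|u - v| * r.
  apply: le_trans (ler_norm _) _; rewrite normrN normrM.
  by rewrite ler_wpM2l// ltW.
lra.
Qed.

(** An enlargement is open, so it is the union of the boxes with rational centre and radius that it
    contains, and these are countably many. *)
Lemma measurable_enlargement (R : realType) (V : nat) (A : set (V.-tuple R))
    (e : R) : measurable (enlargement A e).
Proof.
pose ratbox (p : V.-tuple rat * rat) : set (V.-tuple R) :=
  box (map_tuple ratr p.1) (ratr p.2).
have -> : enlargement A e = \bigcup_p
    (if `[< ratbox p `<=` enlargement A e >] then ratbox p else set0).
  apply/seteqP; split; last first.
    by move=> b [p _]; case: ifPn => // /asboolP; apply.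
  move=> b /[dup] Eb /enlargement_interior[r r0 brE].
  (* A rational centre within r/4 of [b] and a rational radius between r/4 and r/2: the box contains
     [b], and its points stay within 3r/4 of [b] in each coordinate. *)
  have [q qb] : {q : 'I_V -> rat & forall j, `|tnth b j - ratr (q j)| < r / 4}.
    apply: (@choice _ _ (fun j x => `|tnth b j - ratr x| < r / 4)) => j.
    have [x] := @rat_in_itvoo R (tnth b j - r / 4) (tnth b j + r / 4) ltac:(lra).
    rewrite in_itv/= => /andP[? ?]; exists x; rewrite ltr_norml; lra.
  have [s] := @rat_in_itvoo R (r / 4) (r / 2) ltac:(lra).
  rewrite in_itv/= => /andP[s1 s2].
  exists ([tuple q j | j < V], s) => //; rewrite asboolT; last first.
    move=> c /= bc; apply: brE => j.
    have := bc j; rewrite tnth_map tnth_mktuple => cq.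
    rewrite -(subrKA (ratr (q j))).
    apply: le_lt_trans (ler_normD _ _) _.
    have := qb j; rewrite distrC; lra.
  move=> j; rewrite tnth_map tnth_mktuple; exact: lt_trans s1.
apply: countable_bigcupT_measurable => // p.
by case: ifPn => // _; exact: measurable_box.
Qed.

(** Coordinates of two points of the box differ by less than e/V, so the squares sum to less than V
    (e/V)^2 = e^2/V <= e^2. *)
Lemma euclidean_dist_box (R : realType) (V : nat) (c a b : V.-tuple R)
    (e : R) : (0 < V)%N -> 0 < e ->
  box c (e / (2 * V%:R)) a -> box c (e / (2 * V%:R)) b ->
  euclidean_dist a b < e.
Proof.
move=> V0 e0 ca cb; have v0 : (0 : R) < V%:R by rewrite ltr0n.
rewrite /euclidean_dist -[ltRHS](gtr0_norm e0) -sqrtr_sqr ltr_sqrt ?exprn_gt0//.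
have v1 : (1 : R) <= V%:R by rewrite ler1n.
apply: (@lt_le_trans _ _ (\sum_(j < V) (e / V%:R) ^+ 2)).
  apply: ltr_sum => [|j _].
    by apply/hasP; exists (Ordinal V0); rewrite ?mem_index_enum.
  rewrite -real_normK ?num_real// ltrXn2r//.
  rewrite -(subrKA (tnth c j)); apply: le_lt_trans (ler_normD _ _) _.
  have -> : e / V%:R = e / (2 * V%:R) + e / (2 * V%:R) :> R.
    by field; rewrite gt_eqF.
  by rewrite ltrD// distrC; exact: cb.
rewrite sumr_const card_ord -[leLHS]mulr_natr.
have -> : (e / V%:R) ^+ 2 * V%:R = e ^+ 2 / V%:R :> R by field; rewrite gt_eqF.
by rewrite ler_pdivrMr// ler_peMr// sqr_ge0.
Qed.

(** If [A] meets the box, its enlargement contains the whole box and has mass at least 1 - e;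
    otherwise [A] lies in the complement of the box and has mass at most e. So [e] belongs to the
    set whose infimum is taken. *)
Lemma levy_prokhorov_le (R : realType) (V : nat)
    (mu nu : probability (V.-tuple R) R) (c : V.-tuple R) (e : R) :
  (0 < V)%N -> 0 < e ->
  (mu (~` box c (e / (2 * V%:R))) <= e%:E)%E ->
  (nu (~` box c (e / (2 * V%:R))) <= e%:E)%E ->
  0 <= levy_prokhorov mu nu <= e.
Proof.
move=> V0 e0; set B := box _ _ => muB nuB.
have mB : measurable B by exact: measurable_box.
have lp (m n : probability (V.-tuple R) R) (A : set (V.-tuple R)) :
    measurable A -> (m (~` B) <= e%:E)%E -> (n (~` B) <= e%:E)%E ->
    (m A <= n (enlargement A e) + e%:E)%E.
  move=> mA me ne; have [[a [Aa Ba]]|AB] := pselect (exists a, A a /\ B a).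
    apply: (@le_trans _ _ 1%E); first exact: probability_le1.
    have : (n B <= n (enlargement A e))%E.
      apply: le_measure; rewrite ?inE//; first exact: measurable_enlargement.
      by move=> b Bb; exists a => //; exact: euclidean_dist_box Ba Bb.
    move=> nBE; apply: le_trans (leeD nBE (lexx e%:E)).
    by rewrite -leeBlDl ?fin_num_measure// -probability_setC.
  apply: (@le_trans _ _ e%:E); last by rewrite leeDr.
  apply: le_trans me; apply: le_measure; rewrite ?inE//; first exact: measurableC.
  by move=> a Aa Ba; apply: AB; exists a.
have Se : [set r : R | 0 < r /\ forall A : set (V.-tuple R), measurable A ->
    (mu A <= nu (enlargement A r) + r%:E)%E /\
    (nu A <= mu (enlargement A r) + r%:E)%E] e.
  by split => // A mA; split; exact: lp.
have S0 : lbound [set r : R | 0 < r /\ forall A : set (V.-tuple R), measurable A ->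
    (mu A <= nu (enlargement A r) + r%:E)%E /\
    (nu A <= mu (enlargement A r) + r%:E)%E] 0 by move=> r [/ltW].
apply/andP; split; first by apply: lb_le_inf => //; exists e.
by apply: ge_inf => //; exists 0.
Qed.

(** * Measurability of the normalization, and a finite union bound *)

Lemma measurable_inv (R : realType) : measurable_fun [set: R] (@GRing.inv R).
Proof.
(* This reduces inversion to a real power of a nonnegative base; the identity persists at 0, where
   the inverse is 0 by convention. *)
have -> : @GRing.inv R = fun x => x * (x ^+ 2) `^ (-1).
  apply/funext => x; rewrite powR_inv1 ?sqr_ge0//.
  have [->|x0] := eqVneq x 0; first by rewrite mul0r invr0.
  by field.
apply: measurable_funM => //.
apply: (measurableT_comp (measurable_powR _)).
exact: measurable_funX.
Qed.

Lemma measurable_normalize (R : realType) (V : nat) (d : measure_display)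
    (T : measurableType d) (g : 'I_V -> T -> R) :
  (forall j, measurable_fun [set: T] (g j)) ->
  measurable_fun [set: T] (fun o => normalize (g ^~ o)).
Proof.
move=> mg; apply/measurable_fun_tnthP => j.
rewrite [X in measurable_fun _ X](_ : _ =
    (fun o => g j o / \sum_(k < V) g k o)); last first.
  by apply/funext => o /=; rewrite tnth_mktuple.
apply: measurable_funM => //.
by apply: (measurableT_comp (@measurable_inv R)); exact: measurable_sum.
Qed.

Lemma measure_exists_le (R : realType) (d : measure_display)
    (T : measurableType d) (mu : {measure set T -> \bar R}) (I : finType)
    (E : I -> set T) : (forall i, measurable (E i)) ->
  measurable [set o | exists i, E i o] /\
  (mu [set o | exists i, E i o] <= \sum_i mu (E i))%E.
Proof.
move=> mE.
have -> : [set o | exists i, E i o] = \big[setU/set0]_i E i.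
  rewrite -bigcup_seq; apply/seteqP; split => o [i].
    by move=> Eo; exists i => //=; rewrite mem_index_enum.
  by move=> _ Eo; exists i.
elim/big_rec2 : _ => [|i x y _ [mx xy]]; first by rewrite measure0.
split; first exact: measurableU.
by apply: le_trans (measureU2 _ _ _) _ => //; rewrite leeD2l.
Qed.

(** * Stability of the normalization under coordinatewise errors *)

(** The sum S of the y_j is within V r w <= w/2 of w, hence S >= w/2. Then y_j/S - F_j = ((y_j - w
    F_j) - F_j (S - w))/S is smaller in absolute value than (r w + V r w)/(w/2). *)
Lemma box_normalize (R : realType) (V : nat) (F : V.-tuple R) (w r : R)
    (y : 'I_V -> R) :
  probability_vector F -> 0 < w -> V%:R * r <= 2^-1 ->
  (forall j, `|y j - w * tnth F j| < r * w) ->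
  0 < \sum_(j < V) y j /\ box F (2 * (V%:R + 1) * r) (normalize y).
Proof.
move=> [F0 F1] w0 Vr yF.
pose S := \sum_(j < V) y j; rewrite -/S.
have Sw : `|S - w| <= V%:R * (r * w).
  have {1}-> : w = \sum_(j < V) w * tnth F j by rewrite -mulr_sumr F1 mulr1.
  rewrite -sumrB.
  apply: le_trans (ler_norm_sum _ _ _) _.
  rewrite mulr_natl -[in leRHS](card_ord V) -sumr_const.
  by apply: ler_sum => j _; exact: ltW.
have S2 : w / 2 <= S.
  by move: Sw; rewrite ler_norml => /andP[+ _]; nra.
have S0 : 0 < S by lra.
split=> // j; rewrite tnth_mktuple -/S.
have Fj1 : tnth F j <= 1.
  by rewrite -F1 (bigD1 j)//= lerDl sumr_ge0.
have -> : y j / S - tnth F j =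
    (y j - w * tnth F j - tnth F j * (S - w)) / S.
  by field; rewrite gt_eqF.
rewrite normrM normfV (gtr0_norm S0) ltr_pdivrMr//.
apply: le_lt_trans (ler_normB _ _) _.
rewrite normrM (ger0_norm (F0 j)).
have := yF j; have := normr_ge0 (S - w); have := F0 j.
have := normr_ge0 (y j - w * tnth F j).
set a := `|_ - _|; set b := `|S - w|; set f := tnth F j.
move=> a0 f0 b0 aw.
have r0 : 0 < r by nra.
have v0 : (0 : R) <= V%:R by [].
have : f * b <= V%:R * (r * w) by apply: le_trans Sw; rewrite ler_piMl.
have c0 : 0 <= (V%:R + 1) * r by rewrite mulr_ge0 ?addr_ge0// ltW.
have : (V%:R + 1) * r * w <= (V%:R + 1) * r * (2 * S).
  by rewrite ler_wpM2l//; lra.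
lra.
Qed.

(** * Poisson tails from a truncated variance *)

(** The sum telescopes: its N-th term is the increment of the right-hand side from N to N + 1. Once
    N >= l the right-hand side is nonpositive, which bounds the truncated second central moment by
    [l] times the truncated mass. *)
Lemma poisson_variance_sum (R : realType) (l : R) (N : nat) : 0 < l ->
  \sum_(0 <= i < N) (((i%:R - l) ^+ 2 - l) * poisson_pmf l i) =
  (l - N%:R) * N%:R * poisson_pmf l N.
Proof.
move=> l0; elim: N => [|N IH]; first by rewrite big_geq// mulr0 mul0r.
rewrite big_nat_recr//= IH /poisson_pmf l0 factS natrM [l ^+ _.+1]exprS.
rewrite -[N.+1%:R]natr1; field.
by rewrite natr1 !pnatr_eq0 -lt0n fact_gt0.
Qed.

(** Chebyshev's inequality on the partial sums up to N, for all large N, followed by the limit in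
    N. *)
Lemma poisson_tail (R : realType) (l s : R) : 0 < l -> 0 < s ->
  (poisson_prob l 0 [set n | (s <= `|n%:R - l|)%R] <= (l / s ^+ 2)%:E)%E.
Proof.
move=> l0 s0.
have p0 i : 0 <= poisson_pmf l i by exact: poisson_pmf_ge0.
have p1 N : \sum_(0 <= i < N) poisson_pmf l i <= 1.
  have : poisson_prob l 0 [set: nat] = 1%E by exact: probability_setT.
  rewrite /poisson_prob l0 -lee_fin => <-.
  rewrite -sumEFin -nneseries_esumT; last by move=> *; rewrite lee_fin.
  by apply: nneseries_lim_ge => *; rewrite lee_fin.
rewrite /poisson_prob l0.
rewrite -(@nneseries_esum R (fun i => (poisson_pmf l i)%:E)
  (fun n => s <= `|n%:R - l|)); last by move=> *; rewrite lee_fin.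
apply: lime_le; first by apply: is_cvg_nneseries => *; rewrite lee_fin.
near=> N; rewrite sumEFin lee_fin ler_pdivlMr ?exprn_gt0// mulr_suml.
have lN : l <= N%:R by near: N; exact: nbhs_infty_ger.
have : \sum_(0 <= i < N) (((i%:R - l) ^+ 2 - l) * poisson_pmf l i) <= 0.
  rewrite poisson_variance_sum// mulr_le0_ge0// mulr_le0_ge0//.
  by rewrite subr_le0.
under eq_bigr do rewrite mulrBl.
rewrite sumrB -mulr_sumr subr_le0 => h.
apply: le_trans (le_trans h _); last by rewrite ger_pMr.
rewrite big_mkcond; apply: ler_sum => i _; case: ifPn => [si|_]; last first.
  by rewrite mulr_ge0// sqr_ge0.
rewrite mulrC ler_wpM2r// -[leRHS]real_normK ?num_real//.
by rewrite lerXn2r// nnegrE ltW.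
Unshelve. all: by end_near.
Qed.

(** * Gamma tails from a truncated variance *)

(* The antiderivative below makes [(t - a) ^+ 2 - a] integrate to a boundary
   term against the Gamma density, so that the functional equation of [Gamma]
   is never needed. *)
Lemma is_derive_gamma_variance (R : realType) (a t : R) : 0 < t ->
  is_derive t 1 (fun u => - (u `^ a * (u + 1 - a) * expR (- u)))
    (((t - a) ^+ 2 - a) * (t `^ (a - 1) * expR (- t))).
Proof.
move=> t0.
have -> : ((t - a) ^+ 2 - a) * (t `^ (a - 1) * expR (- t)) =
    - ((a * t `^ (a - 1) * (t + 1 - a) + t `^ a) * expR (- t) -
       t `^ a * (t + 1 - a) * expR (- t)).
  have -> : t `^ a = t `^ (a - 1) * t.
    rewrite -[X in _ = _ * X](powRr1 (ltW t0)) -powRD ?subrK//.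
    by rewrite (gt_eqF t0) implybT.
  ring.
have dexp : is_derive t 1 (fun u : R => expR (- u)) (- expR (- t)).
  have := is_derive1_comp (is_derive_expR (- t)) (is_deriveNid t 1).
  by rewrite mulrN1.
have dlin : is_derive t 1 (fun u : R => u + 1 - a) 1.
  have -> : (fun u : R => u + 1 - a) = id + cst (1 - a).
    by apply/funext => u /=; rewrite addrA.
  by apply: is_derive_eq; rewrite addr0.
have dpow := is_derive1_powR a t0.
apply: is_derive_eq.
rewrite /GRing.scale/=; ring.
Qed.

Lemma derivable1_continuous (R : realType) (f : R -> R) (t df : R) :
  is_derive t (1 : R) f df -> {for t, continuous f}.
Proof.
move=> dft; apply: differentiable_continuous; apply/derivable1_diffP.
exact: ex_derive.
Qed.

Lemma continuous_gamma_kernel (R : realType) (a t : R) : 0 < t ->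
  {for t, continuous (fun u : R => u `^ (a - 1) * expR (- u))}.
Proof.
move=> t0; apply: cvgM.
  exact: derivable1_continuous (is_derive1_powR (a - 1) t0).
by apply: continuous_comp; [exact: opp_continuous|exact: continuous_expR].
Qed.

Lemma continuous_gamma_variance (R : realType) (a t : R) : 0 < t ->
  {for t, continuous
    (fun u : R => ((u - a) ^+ 2 - a) * (u `^ (a - 1) * expR (- u)))}.
Proof.
move=> t0; apply: cvgM; last exact: continuous_gamma_kernel.
apply: cvgB; last exact: cvg_cst.
apply: (@cvg_comp _ _ _ (fun u : R => u - a) (fun u => u ^+ 2)).
  by apply: cvgB; [exact: cvg_id|exact: cvg_cst].
exact: exprn_continuous.
Qed.

Lemma continuous_within_segment (R : realType) (f : R -> R) (e b : R) :
  0 < e -> (forall t, 0 < t -> {for t, continuous f}) ->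
  {within `[e, b], continuous f}.
Proof.
move=> e0 cf; apply: continuous_in_subspaceT => t.
by rewrite inE/= in_itv/= => /andP[et _]; apply: cf; exact: lt_le_trans et.
Qed.

(** Fundamental theorem of calculus for the antiderivative of [is_derive_gamma_variance]. The
    segment starts at [e > 0] because t^(a-1) is singular at 0 when a < 1. *)
Lemma integral_gamma_variance (R : realType) (a e b : R) : 0 < e -> e < b ->
  (\int[lebesgue_measure]_(t in `[e, b])
     (((t - a) ^+ 2 - a) * (t `^ (a - 1) * expR (- t)))%:E =
   (e `^ a * (e + 1 - a) * expR (- e) - b `^ a * (b + 1 - a) * expR (- b))%:E)%E.
Proof.
move=> e0 eb.
have dG (t : R) := @is_derive_gamma_variance R a t.
rewrite (@continuous_FTC2 _ _
  (fun u : R => - (u `^ a * (u + 1 - a) * expR (- u))))//.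
- by rewrite -EFinB; congr (_%:E); ring.
- apply: continuous_within_segment => // t; exact: continuous_gamma_variance.
- split.
  + move=> t; rewrite in_itv/= => /andP[et _].
    exact: (@ex_derive _ _ _ _ _ _ _ (dG _ (lt_trans e0 et))).
  + apply: cvg_at_right_filter; exact: derivable1_continuous (dG _ e0).
  + apply: cvg_at_left_filter.
    exact: derivable1_continuous (dG _ (lt_trans e0 eb)).
- move=> t; rewrite in_itv/= => /andP[et _].
  by rewrite derive1E; have [_ ->] := dG _ (lt_trans e0 et).
Qed.

Lemma measurable_deviation (R : realType) (a s : R) :
  measurable [set t : R | s <= `|t - a|].
Proof.
have -> : [set t : R | s <= `|t - a|] = ~` ball a s.
  apply/seteqP; split => t; rewrite /ball/= distrC leNgt; last by move/negP.
  by move/negP.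
by apply: measurableC; exact: measurable_ball.
Qed.

(** Chebyshev's inequality on a segment, where the variance integral is explicit up to boundary
    terms. The term in e^a bounds the contribution of the lower endpoint and vanishes as e tends to
    0. *)
Lemma gamma_chebyshev (R : realType) (mu : probability R R) (a s e b : R) :
  0 < a -> 0 < s -> 0 < e -> e < b -> e <= 1 -> a - 1 <= b ->
  (forall U : set R, measurable U -> mu U = gamma_law a U) ->
  (mu ([set t | (s <= `|t - a|)%R] `&` `[e, b]) <=
    ((a + 2 * (Gamma a)^-1 * e `^ a) / s ^+ 2)%:E)%E.
Proof.
move=> a0 s0 e0 eb e1 ab muE.
set U := [set t | _] `&` _.
have mU : measurable U by apply: measurableI => //; exact: measurable_deviation.
set c := (Gamma a)^-1.
(* The sign comes from the integrand of [Gamma]; the total mass of the density enters later, through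
   [mu] being a probability. *)
have c0 : 0 <= c.
  rewrite invr_ge0; apply: Rintegral_ge0 => t _.
  by rewrite mulr_ge0 ?powR_ge0 ?expR_ge0.
pose h (t : R) := t `^ (a - 1) * expR (- t).
have h0 t : 0 <= h t by rewrite mulr_ge0 ?powR_ge0 ?expR_ge0.
have mh : measurable_fun [set: R] h.
  apply: measurable_funM => //; apply: (measurableT_comp (@measurable_expR R)).
  exact: oppr_measurable.
have muh A : measurable A -> A `<=` `[e, b] ->
    mu A = (\int[lebesgue_measure]_(t in A) (c * h t)%:E)%E.
  move=> mA Aeb; rewrite muE// /gamma_law a0; apply: eq_integral => t.
  rewrite inE => /Aeb; rewrite /= in_itv/= => /andP[et _].
  by rewrite /gamma_pdf (lt_le_trans e0 et) mulrC.
have msq : measurable_fun [set: R] (fun t => c * ((t - a) ^+ 2 * h t)).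
  apply: measurable_funM => //; apply: measurable_funM => //.
  by apply: measurable_funX; exact: measurable_funB.
have sq0 t : 0 <= c * ((t - a) ^+ 2 * h t).
  by rewrite mulr_ge0// mulr_ge0// sqr_ge0.
have ih : lebesgue_measure.-integrable `[e, b] (EFin \o h).
  apply: continuous_compact_integrable; first exact: segment_compact.
  by apply: continuous_within_segment => // t; exact: continuous_gamma_kernel.
have iq : lebesgue_measure.-integrable `[e, b]
    (EFin \o (fun t => ((t - a) ^+ 2 - a) * h t)).
  apply: continuous_compact_integrable; first exact: segment_compact.
  by apply: continuous_within_segment => // t; exact: continuous_gamma_variance.
have muU : ((s ^+ 2)%:E * mu U <=
    \int[lebesgue_measure]_(t in `[e, b]) (c * ((t - a) ^+ 2 * h t))%:E)%E.
  rewrite muh//; last by move=> t [].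
  rewrite -ge0_integralZl//; first last.
  - by rewrite lee_fin sqr_ge0.
  - by move=> t _; rewrite lee_fin mulr_ge0.
  - apply/measurable_EFinP; apply: measurable_funTS; exact: measurable_funM.
  apply: (@le_trans _ _
    (\int[lebesgue_measure]_(t in U) (c * ((t - a) ^+ 2 * h t))%:E)%E).
    apply: ge0_le_integral => //.
    - by move=> t _; rewrite -EFinM lee_fin mulr_ge0 ?sqr_ge0// mulr_ge0.
    - under eq_fun do rewrite -EFinM.
      apply/measurable_EFinP; apply: measurable_funTS.
      by apply: measurable_funM => //; exact: measurable_funM.
    - by apply/measurable_EFinP; exact: measurable_funTS.
    - move=> t [/= st _]; rewrite -EFinM lee_fin mulrCA ler_wpM2l// ler_wpM2r//.
      by rewrite -[leRHS]real_normK ?num_real// lerXn2r// nnegrE ltW.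
  apply: ge0_subset_integral => //.
  - by apply/measurable_EFinP; exact: measurable_funTS.
  - by move=> t _; rewrite lee_fin.
  - by move=> t [].
have {muU} : ((s ^+ 2)%:E * mu U <= (a + 2 * c * e `^ a)%:E)%E.
  apply: le_trans muU _.
  (* Splitting (t - a)^2 as ((t - a)^2 - a) + a leaves the boundary terms plus [a] times the mass of
     the segment, which is at most 1. *)
  have -> : (\int[lebesgue_measure]_(t in `[e, b]) (c * ((t - a) ^+ 2 * h t))%:E =
      \int[lebesgue_measure]_(t in `[e, b])
        (c%:E * (((t - a) ^+ 2 - a) * h t)%:E + a%:E * (c * h t)%:E))%E.
    apply: eq_integral => t _; rewrite -!EFinM -EFinD; congr (_%:E); ring.
  rewrite integralD//; first last.
  - apply: integrableZl => //.
    exact: (integrableZl _ c ih).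
  - exact: integrableZl.
  rewrite integralZl// integral_gamma_variance// ge0_integralZl//; first last.
  - by rewrite lee_fin ltW.
  - by move=> t _; rewrite lee_fin mulr_ge0.
  - apply/measurable_EFinP; apply: measurable_funTS; exact: measurable_funM.
  rewrite -muh// -EFinM addeC EFinD; apply: leeD.
    rewrite -[leRHS]mule1; apply: lee_wpmul2l; first by rewrite lee_fin ltW.
    exact: probability_le1.
  (* The boundary term at [b] is subtracted and nonnegative, since a - 1 <= b, so it is dropped. The
     one at [e] is at most 2 e^a, since e + 1 - a <= 2 and exp(-e) <= 1. *)
  have -> : 2 * c * e `^ a = c * (2 * e `^ a) by ring.
  rewrite lee_fin ler_wpM2l//.
  have eN : expR (- e) <= 1 by rewrite expR_le1 oppr_le0 ltW.
  have eN0 := expR_ge0 (- e).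
  have ea0 := powR_ge0 e a.
  have b0 : 0 <= b `^ a * (b + 1 - a) * expR (- b).
    by rewrite !mulr_ge0 ?powR_ge0 ?expR_ge0//; lra.
  apply: (@le_trans _ _ (e `^ a * (e + 1 - a) * expR (- e))).
    by rewrite gerBl.
  rewrite -mulrA [leRHS]mulrC ler_wpM2l//.
  nra.
rewrite -lee_pdivlMl ?exprn_gt0// => /le_trans; apply.
by rewrite -EFinM mulrC.
Qed.

(** The segments [1/(n+2), n+2+a] exhaust the positive half-line, and the nonpositive half-line is
    null. Continuity from below passes the truncated bounds to the limit, where the error e^a
    disappears because a > 0. *)
Lemma gamma_tail (R : realType) (mu : probability R R) (a s : R) :
  0 < a -> 0 < s ->
  (forall U : set R, measurable U -> mu U = gamma_law a U) ->
  (mu [set t | (s <= `|t - a|)%R] <= (a / s ^+ 2)%:E)%E.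
Proof.
move=> a0 s0 muE; have mU := measurable_deviation a s.
set U := [set t | _] in mU *.
pose e n : R := n.+2%:R^-1.
pose K n := U `&` `[e n, n.+2%:R + a].
have e0 n : 0 < e n by rewrite invr_gt0 ltr0n.
have mK n : measurable (K n) by exact: measurableI.
have mbK : measurable (\bigcup_n K n) by exact: bigcup_measurable.
have muK : (mu (\bigcup_n K n) <= (a / s ^+ 2)%:E)%E.
  have ndK : {homo K : n m / (n <= m)%N >-> (n <= m)%O}.
    move=> n m nm; apply/subsetPset => t [Ut]; rewrite /= in_itv/= => /andP[ent tn].
    split => //=; rewrite in_itv/=; apply/andP; split.
      by apply: le_trans ent; rewrite lef_pV2 ?posrE ?ltr0n// ler_nat !ltnS.
    by apply: le_trans tn _; rewrite lerD2r ler_nat !ltnS.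
  have Kle n : (mu (K n) <= ((a + 2 * (Gamma a)^-1 * e n `^ a) / s ^+ 2)%:E)%E.
    have n2 : (2 : R) <= n.+2%:R by rewrite ler_nat.
    have en : e n <= 1 by rewrite invf_le1 ?ltr0n// (le_trans _ n2)// ler1n.
    by apply: gamma_chebyshev => //; lra.
  have cvgK := nondecreasing_cvg_mu (mu := mu) mK mbK ndK.
  have eto0 : e n @[n --> \oo] --> 0.
    (* [harmonic] is 1/(n+1); shifting the index by one gives 1/(n+2). *)
    by have := @cvg_harmonic R; rewrite -cvg_shiftS.
  have cvgB : ((a + 2 * (Gamma a)^-1 * e n `^ a) / s ^+ 2)%:E @[n --> \oo] -->
      (a / s ^+ 2)%:E.
    apply: cvg_EFin; first by near=> n.
    apply: cvgMr_tmp.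
    rewrite -[X in _ --> X]addr0; apply: cvgD; first exact: cvg_cst.
    rewrite -(mulr0 (2 * (Gamma a)^-1)); apply: cvgMl_tmp.
    by have /cvg_at_rightP := powR_cvg0 a0; apply.
  by apply: lee_cvg_to cvgK cvgB _; near=> n; exact: Kle.
have mu0 : mu `]-oo, 0]%classic = 0%E.
  rewrite muE// /gamma_law a0; apply: integral0_eq => t.
  by rewrite /= in_itv/= /gamma_pdf => t0; rewrite ltNge t0.
apply: le_trans muK.
rewrite -[leRHS]add0e -mu0.
apply: le_trans (measureU2 _ _ _) => //.
apply: le_measure; rewrite ?inE//; first exact: measurableU.
move=> t Ut; have [t0|t0] := leP t 0; [by left; rewrite /= in_itv|right].
have ti : 0 < t^-1 by rewrite invr_gt0.
(* A single index above 1/t + t places t between both endpoints. *)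
have [n tn] : exists n : nat, t^-1 + t <= n%:R.
  exists (Num.bound (t^-1 + t)); apply/ltW/archi_boundP; lra.
have nn : (n%:R : R) <= n.+2%:R by rewrite ler_nat -addn2 leq_addr.
exists n => //; split => //=; rewrite in_itv/=; apply/andP; split; last by lra.
rewrite -[leRHS]invrK lef_pV2 ?posrE ?ltr0n//; lra.
Unshelve. all: by end_near.
Qed.

(** Entries of the mean vector may vanish: for a = 0 the law is the Dirac mass at 0, which the tail
    event avoids because s > 0. [poisson_prob_tail] treats rate 0 in the same way. *)
Lemma gamma_law_tail (R : realType) (mu : probability R R) (a s : R) :
  0 <= a -> 0 < s ->
  (forall U : set R, measurable U -> mu U = gamma_law a U) ->
  (mu [set t | (s <= `|t - a|)%R] <= (a / s ^+ 2)%:E)%E.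
Proof.
rewrite le_eqVlt => /predU1P[<-|a0] s0 muE; last exact: gamma_tail.
rewrite muE; last exact: measurable_deviation.
rewrite /gamma_law ltxx mul0r diracE memNset// /= subrr normr0.
by apply/negP; rewrite -ltNge.
Qed.

Lemma poisson_prob_tail (R : realType) (l s : R) : 0 <= l -> 0 < s ->
  (poisson_prob l 0 [set n | (s <= `|n%:R - l|)%R] <= (l / s ^+ 2)%:E)%E.
Proof.
rewrite le_eqVlt => /predU1P[<-|l0] s0; last exact: poisson_tail.
rewrite /poisson_prob ltxx mul0r diracE memNset// /= subrr normr0.
by apply/negP; rewrite -ltNge.
Qed.


(** * Concentration of the normalized vectors around the mean *)

(* Union bound: the right-hand sides add up to [(r ^+ 2 * w)^-1] because the
   entries of [F] sum to 1; independence of the coordinates plays no role. *)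
Lemma normalize_concentration (R : realType) (V : nat) (F : V.-tuple R)
    (w r : R) (d : measure_display) (T : measurableType d)
    (P : probability T R) (y : 'I_V -> T -> R) :
  probability_vector F -> 0 < w -> 0 < r -> V%:R * r <= 2^-1 ->
  (forall j, measurable_fun [set: T] (y j)) ->
  (forall j, (P [set o | (r * w <= `|y j o - w * tnth F j|)%R] <=
     (w * tnth F j / (r * w) ^+ 2)%:E)%E) ->
  exists E : set T, [/\ measurable E, (P E <= ((r ^+ 2 * w)^-1)%:E)%E &
    forall o, ~ E o -> 0 < \sum_(j < V) y j o /\
      box F (2 * (V%:R + 1) * r) (normalize (y ^~ o))].
Proof.
move=> Fp w0 r0 Vr my tail.
have mE j : measurable [set o | r * w <= `|y j o - w * tnth F j|].
  rewrite -[X in measurable X]setTI.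
  exact: (my j measurableT _ (measurable_deviation _ _)).
have [mU PU] := measure_exists_le P mE.
eexists; split; first exact: mU.
  apply: le_trans PU _.
  apply: (@le_trans _ _ (\sum_(j < V) (w * tnth F j / (r * w) ^+ 2)%:E)%E).
    by apply: lee_sum => j _; exact: tail.
  rewrite sumEFin -mulr_suml -mulr_sumr; have [_ ->] := Fp.
  rewrite lee_fin mulr1 (_ : w / _ = (r ^+ 2 * w)^-1)//.
  by field; rewrite (gt_eqF w0) (gt_eqF r0).
move=> o nE; apply: (box_normalize Fp w0 Vr) => j.
by rewrite ltNge; apply/negP => h; apply: nE; exists j.
Qed.

Lemma dirichlet_concentration (R : realType) (V : nat) (F : V.-tuple R)
    (w r : R) (d : measure_display) (T : measurableType d)
    (P : probability T R) (x : {RV P >-> V.-tuple R}) :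
  probability_vector F -> 0 < w -> 0 < r -> V%:R * r <= 2^-1 ->
  is_dirichlet w F x ->
  (distribution P x (~` box F (2 * (V%:R + 1) * r)) <= ((r ^+ 2 * w)^-1)%:E)%E.
Proof.
move=> Fp w0 r0 Vr [d0 [T0 [P0 [g [_ glaw xlaw]]]]].
have mB := measurable_box F (2 * (V%:R + 1) * r).
have [//|//|E [mE PE goodE]] := @normalize_concentration R V F w r _ _ P0 g Fp w0 r0 Vr.
  move=> j.
  have := @gamma_law_tail R (distribution P0 (g j)) (w * tnth F j) (r * w).
  apply.
  - by have [F0 _] := Fp; rewrite mulr_ge0 ?(ltW w0).
  - exact: mulr_gt0.
  - exact: glaw.
rewrite xlaw; last exact: measurableC.
apply: le_trans PE; apply: le_measure; rewrite ?inE//.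
  rewrite -[X in measurable X]setTI.
  apply: measurable_normalize => //; exact: measurableC.
by move=> o /= nB; apply: contrapT => /goodE[_ /nB].
Qed.

(** Conditioning costs at most a factor 2: off the exceptional event [E] the sum is positive, and
    [E] has probability at most 1/2 when r^2 w >= 2, so the conditioning event has probability at
    least 1/2. *)
Lemma ppu_concentration (R : realType) (V : nat) (F : V.-tuple R)
    (w r : R) (d : measure_display) (T : measurableType d)
    (P : probability T R) (x : {RV P >-> V.-tuple R}) :
  probability_vector F -> 0 < w -> 0 < r -> V%:R * r <= 2^-1 ->
  2 <= r ^+ 2 * w -> is_ppu w F x ->
  (distribution P x (~` box F (2 * (V%:R + 1) * r)) <=
    (2 * (r ^+ 2 * w)^-1)%:E)%E.
Proof.
move=> Fp w0 r0 Vr rw2 [d0 [T0 [P0 [g [_ glaw xlaw]]]]].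
have mB := measurable_box F (2 * (V%:R + 1) * r).
pose y j (o : T0) : R := (g j o)%:R.
have my j : measurable_fun [set: T0] (y j).
  by apply: (@measurableT_comp _ _ _ _ _ _ (fun n : nat => n%:R : R)).
have [//|//|E [mE PE goodE]] := @normalize_concentration R V F w r _ _ P0 y Fp w0 r0 Vr.
  move=> j; have := @poisson_prob_tail R (w * tnth F j) (r * w).
  rewrite -glaw; apply; last exact: mulr_gt0.
  by have [F0 _] := Fp; rewrite mulr_ge0 ?(ltW w0).
rewrite xlaw; last exact: measurableC.
set N := [set o | (_ <> 0)%N].
(* Restated with the real sum, the conditioning event is visibly measurable and matches the
   positivity supplied by [goodE]. *)
have NE o : N o = (0 < \sum_(j < V) y j o).
  rewrite /y -natr_sum ltr0n lt0n /N/=; apply/propext; split.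
    by move=> h; apply/eqP.
  by move/eqP.
have mN : measurable N.
  have -> : N = [set: T0] `&` (fun o => \sum_(j < V) y j o) @^-1` `]0, +oo[.
    by apply/seteqP; split => o; rewrite NE /= in_itv/= andbT => // -[].
  by apply: measurable_sum.
set A := [set o | _].
have mA : measurable A.
  rewrite -[X in measurable X]setTI.
  apply: measurable_normalize => //; exact: measurableC.
have PA : fine (P0 (A `&` N)) <= (r ^+ 2 * w)^-1.
  rewrite -lee_fin fineK ?fin_num_measure//; last exact: measurableI.
  apply: le_trans PE; apply: le_measure; rewrite ?inE//; first exact: measurableI.
  by move=> o [/= nB _]; apply: contrapT => /goodE[_ /nB].
have rwi : (r ^+ 2 * w)^-1 <= 2^-1 by rewrite lef_pV2// posrE; lra.
have PN : 2^-1 <= fine (P0 N).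
  have : (P0 (~` N) <= ((r ^+ 2 * w)^-1)%:E)%E.
    apply: le_trans PE; apply: le_measure; rewrite ?inE//; first exact: measurableC.
    by move=> o /= nN; apply: contrapT => /goodE[]; rewrite -NE.
  rewrite probability_setC// -(@fineK _ (P0 N)) ?fin_num_measure//.
  rewrite -EFinB lee_fin; lra.
rewrite lee_fin ler_pdivrMr; last lra.
have : 0 <= (r ^+ 2 * w)^-1 by rewrite invr_ge0; lra.
nra.
Qed.

(** * Choice of the radius and the limit of large concentration *)

Theorem theorem3p3 (R : realType) (V : nat) (hV : (1 <= V)%N)
    (F : R -> V.-tuple R)
    (hF : forall w : R, 0 < w -> probability_vector (F w))
    (d : R -> measure_display) (T : forall w : R, measurableType (d w))
    (P : forall w : R, probability (T w) R)
    (x : forall w : R, {RV (P w) >-> V.-tuple R})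
    (d' : R -> measure_display) (T' : forall w : R, measurableType (d' w))
    (P' : forall w : R, probability (T' w) R)
    (x' : forall w : R, {RV (P' w) >-> V.-tuple R})
    (hx : forall w : R, 0 < w -> is_ppu w (F w) (x w))
    (hx' : forall w : R, 0 < w -> is_dirichlet w (F w) (x' w)) :
  levy_prokhorov (distribution (P w) (x w)) (distribution (P' w) (x' w))
    @[w --> +oo] --> (0 : R).
Proof.
apply/cvgrPdist_le => /= e0 e0_gt0.
(* The cap at 1 is what gives V r <= 1/2 and turns 2/e <= r^2 w into 2 <= r^2 w. *)
pose e := Num.min e0 1.
have e_gt0 : 0 < e by rewrite lt_min e0_gt0 ltr01.
have e_le1 : e <= 1 by rewrite ge_min lexx orbT.
have v1 : (1 : R) <= V%:R by rewrite ler1n.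
(* Chosen so that the concentration radius 2 (V + 1) r equals the radius e/(2V) of
   [levy_prokhorov_le]. *)
pose r : R := e / (4 * V%:R * (V%:R + 1)).
have r_gt0 : 0 < r by rewrite divr_gt0// !mulr_gt0//; lra.
have rE : 2 * (V%:R + 1) * r = e / (2 * V%:R).
  by rewrite /r; field; apply/andP; split; apply/lt0r_neq0; lra.
have Vr : V%:R * r <= 2^-1.
  have -> : V%:R * r = e / (4 * (V%:R + 1)).
    by rewrite /r; field; apply/andP; split; apply/lt0r_neq0; lra.
  by rewrite ler_pdivrMr; lra.
have r2_gt0 : 0 < r ^+ 2 by rewrite exprn_gt0.
near=> w.
have w_gt0 : 0 < w by near: w; exact: nbhs_pinfty_gt.
(* This makes the larger of the two tail bounds, 2/(r^2 w), at most e. The threshold on [w] depends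
   only on [e] and [V], so [F] may vary with [w]. *)
have rw : 2 / e <= r ^+ 2 * w.
  rewrite [leRHS]mulrC -ler_pdivrMr//; near: w; exact: nbhs_pinfty_ge.
have rw2 : 2 <= r ^+ 2 * w.
  by apply: le_trans rw; rewrite ler_pdivlMr//; lra.
have i_ge0 : 0 <= (r ^+ 2 * w)^-1 by rewrite invr_ge0; lra.
have ie : 2 * (r ^+ 2 * w)^-1 <= e.
  by rewrite ler_pdivrMr; [rewrite [leRHS]mulrC -ler_pdivrMr|lra].
have /andP[lp0 lpe] : 0 <= levy_prokhorov (distribution (P w) (x w))
    (distribution (P' w) (x' w)) <= e.
  apply: (@levy_prokhorov_le _ _ _ _ (F w)) => //; rewrite -rE.
    apply: le_trans (ppu_concentration (hF w w_gt0) w_gt0 r_gt0 Vr rw2 (hx w w_gt0)) _.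
    by rewrite lee_fin.
  apply: le_trans (dirichlet_concentration (hF w w_gt0) w_gt0 r_gt0 Vr (hx' w w_gt0)) _.
  rewrite lee_fin; lra.
rewrite sub0r normrN ger0_norm//; apply: le_trans lpe _.
by rewrite ge_min lexx.
Unshelve. all: by end_near.
Qed.
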